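(* For all integers $n\ge0$ (with $c,q$ generic nonzero parameters), the classical $q$-Lommel polynomials $h_n(x;c,q)$ are the following limits of associated Askey--Wilson polynomials: $$h_{2n}(x;c,q)=\lim_{\alpha\to\infty}\frac{(-2)^n}{\alpha^{2n}}\,\psi_n^{(\alpha,2)}\!\left(-\frac{\alpha^2x^2}{2};\,q\right)\quad\text{with }(A,B,C,D)=\left(1,\frac{q}{\alpha^2},c,1\right),$$ $$h_{2n+1}(x;c,q)=x\lim_{\alpha\to\infty}\frac{(-2q)^n}{\alpha^{2n}}\,\psi_n^{(\alpha,1)}\!\left(-\frac{\alpha^2x^2}{2q};\,q\right)\quad\text{with }(A,B,C,D)=\left(1,\frac{q^2}{\alpha^2},c,1\right).$$
   Context: Notation: $(a;q)_n=\prod_{i=0}^{n-1}(1-aq^i)$ and $(a_1,\dots,a_r;q)_n=\prod_j(a_j;q)_n$. The classical $q$-Lommel polynomials are defined by $h_{-1}(x;c,q)=0$, $h_0(x;c,q)=1$, $h_{n+1}(x;c,q)=x\,h_n(x;c,q)-\lambda_nh_{n-1}(x;c,q)$ for $n\ge0$, where $\lambda_n=\dfrac{cq^{n-1}}{(1-cq^{n-1})(1-cq^n)}$. The very-well-poised series is $${}_{10}W_9(u;e_1,\dots,e_7;q;T)=\sum_{s\ge0}\frac{1-uq^{2s}}{1-u}\,\frac{(u,e_1,\dots,e_7;q)_s}{(q,uq/e_1,\dots,uq/e_7;q)_s}\,T^s .$$ The associated Askey--Wilson polynomials $\psi_n^{(\alpha,\epsilon)}(x;q)$, $\epsilon\in\{1,2\}$,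 with parameters $A,B,C,D$, association parameter $\alpha$ and base $q$ are the monic polynomials of degree $n$ in $x=\frac12(z+z^{-1})$ given by $$\psi_n^{(\alpha,\epsilon)}(x;q)=K_n\sum_{k=0}^n\frac{(q^{-n},ABCD\alpha^2q^{n-1},ABCD\alpha^2/q,Az,A/z;q)_k}{(q,AB\alpha,AC\alpha,AD\alpha,ABCD\alpha/q;q)_k}\,q^k\;W_k,$$ $$W_k={}_{10}W_9\!\left(ABCD\alpha^2q^{k-2};\,\alpha,\,BC\alpha/q,\,BD\alpha/q,\,CD\alpha/q,\,S,\,ABCD\alpha^2q^{n+k-1},\,q^{k-n};\,q;\,T\right),$$ where $$K_n=(2A)^{-n}\frac{(AB\alpha,AC\alpha,AD\alpha,ABCD\alpha/q;q)_n}{(ABCD\alpha^2q^{n-1},ABCD\alpha^2/q;q)_n},$$ and $(S,T)=(q^{k+1},A^2)$ if $\epsilon=1$, $(S,T)=(q^k,qA^2)$ if $\epsilon=2$. The series $W_k$ terminates (it is a sum over $0\le s\le n-k$). Limits are coefficientwise in $x$. *)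

(* Defs.v *)
From HB Require Import structures.
From mathcomp Require Import all_boot all_order all_algebra.
From mathcomp Require Import ring.
From mathcomp Require Import boolp classical_sets topology normedtype.

Set Implicit Arguments.
Unset Strict Implicit.
Unset Printing Implicit Defensive.

Import Order.TTheory GRing.Theory Num.Theory.
Import numFieldTopology.Exports numFieldNormedType.Exports.

Local Open Scope classical_set_scope.
Local Open Scope ring_scope.

Section QSeries.
Variable K : fieldType.
Implicit Types (a q u T : K).

Definition qpoch a q (n : nat) : K := \prod_(i < n) (1 - a * q ^+ i).

Definition qpochs (s : seq K) q (n : nat) : K := \prod_(a <- s) qpoch a q n.

(* The sum of the terms 0 <= s <= N of the very-well-poised series
   10W9(u; e_1, ..., e_7; q; T).  The bound is explicit because in the series
   W_k below the factor u q / e_6 = q ^ (- n) makes the terms with s > n of the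
   form 0 / 0; W_k is by convention the sum over 0 <= s <= n - k. *)
Definition W109 u (e : 7.-tuple K) q T (N : nat) : K :=
  \sum_(s < N.+1)
    (1 - u * q ^+ (2 * s)) / (1 - u) *
    (qpochs (u :: e) q s / qpochs (q :: [seq u * q / ei | ei <- e]) q s) *
    T ^+ s.

End QSeries.

Section QLommel.
Variables (K : fieldType) (c q : K).

Definition qlommel_lambda (n : nat) : K :=
  c * q ^ (n%:Z - 1) / ((1 - c * q ^ (n%:Z - 1)) * (1 - c * q ^+ n)).

(* qlommel_pair n = (h_{n-1}, h_n) *)
Fixpoint qlommel_pair (n : nat) : {poly K} * {poly K} :=
  if n is m.+1 then
    let: (hp, h) := qlommel_pair m in (h, 'X * h - qlommel_lambda m *: hp)
  else (0, 1).

Definition qlommel (n : nat) : {poly K} := (qlommel_pair n).2.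

End QLommel.

Section AssociatedAskeyWilson.
Variable K : fieldType.

(* (A z, A / z; q)_k as a polynomial in x = (z + 1/z) / 2, see aw_basisE *)
Definition aw_basis (A q : K) (k : nat) : {poly K} :=
  \prod_(i < k) (1 - (2 * A * q ^+ i) *: 'X + ((A * q ^+ i) ^+ 2)%:P).

Lemma aw_basisE (A q z : K) (k : nat) : 2 != 0 :> K -> z != 0 ->
  (aw_basis A q k).[(z + z^-1) / 2] = qpochs [:: A * z; A / z] q k.
Proof.
move=> n2 nz; rewrite /qpochs big_cons big_seq1 /qpoch -big_split /=.
rewrite horner_prod; apply: eq_bigr => i _; rewrite !hornerE /=.
by field; rewrite nz n2.
Qed.

Variant aw_type := Eps1 | Eps2.

Definition assocAW (eps : aw_type) (A B C D alpha q : K) (n : nat) :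
    {poly K} :=
  let P := A * B * C * D * alpha ^+ 2 in
  let Kn :=
    (2 * A) ^- n *
    (qpochs [:: A * B * alpha; A * C * alpha; A * D * alpha;
                A * B * C * D * alpha / q] q n /
     qpochs [:: P * q ^ (n%:Z - 1); P / q] q n) in
  let W (k : nat) :=
    let: (Sk, Tk) :=
      match eps with
      | Eps1 => (q ^+ k.+1, A ^+ 2)
      | Eps2 => (q ^+ k, q * A ^+ 2)
      end in
    W109 (P * q ^ (k%:Z - 2))
      [tuple alpha; B * C * alpha / q; B * D * alpha / q; C * D * alpha / q;
             Sk; P * q ^ (n%:Z + k%:Z - 1); q ^ (k%:Z - n%:Z)]
      q Tk (n - k) in
  Kn *: \sum_(k < n.+1)
    (qpochs [:: q ^- n; P * q ^ (n%:Z - 1); P / q] q k /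
     qpochs [:: q; A * B * alpha; A * C * alpha; A * D * alpha;
                A * B * C * D * alpha / q] q k *
     q ^+ k * W k) *: aw_basis A q k.

End AssociatedAskeyWilson.

Section LimitAtInfinity.
Variable K : numFieldType.

(* The filter of neighbourhoods of infinity: the sets containing
   {a | M < |a|} for some M. *)
Definition at_infty : set_system K :=
  filter_from [set M : K | M \is Num.real] (fun M => [set a | M < `|a|]).

Global Instance at_infty_proper_filter : ProperFilter at_infty.
Proof.
apply: filter_from_proper.
  apply: filter_from_filter; first by exists 0; exact: real0.
  move=> M N /= Mr Nr; exists (Num.max M N); first exact: max_real.
  by move=> a /=; rewrite comparable_gt_max ?real_comparable // => /andP.
move=> M Mr; exists (`|M| + 1) => /=.
rewrite (@ger0_norm _ (`|M| + 1)) ?addr_ge0 //.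
by rewrite (le_lt_trans (real_ler_norm Mr)) // ltrDl.
Qed.

Definition coef_lim_infty (P : K -> {poly K}) (L : {poly K}) : Prop :=
  forall i : nat, (fun alpha => (P alpha)`_i) @ at_infty --> L`_i.

End LimitAtInfinity.

(* Main.v *)
Require Import Defs.
From mathcomp Require Import all_boot all_order all_algebra.
From mathcomp Require Import ring zify.
From mathcomp Require Import boolp classical_sets topology normedtype.

(** The two limits are one statement, indexed by an exponent [d]: [d = 0] for
    the even polynomials ([Eps2]) and [d = 1] for the odd ones ([Eps1]).  In
    both cases [B = q ^ (d + 1) / alpha ^ 2], so that [ABCD alpha ^ 2] does not
    depend on [alpha], and every other factor of the associated Askey--Wilson
    polynomial is a constant, a product [(b / alpha; q)_m], which tends to [1],
    or a product [(b alpha; q)_m], which is of order [alpha ^ m].  After the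
    substitution [x -> - alpha ^ 2 x ^ 2 / (2 q ^ d)], the factor
    [(A z, A / z; q)_k] is of order [alpha ^ (2 k)].  All powers of [alpha]
    compensate ([assocAW_rescaled]), so the limit can be taken term by term
    ([coef_lim_assocAW]).

    In the limit, the eight-parameter inner series [W_k] loses four of its
    parameters to powers of [q] and becomes the terminating series
    [6W5 (c q^(k+d-1); q^(k+d), c q^(n+k+d), q^(k-n); q, q^(-2k-d))].  This is
    exactly the argument for which the 6W5 series is summable in closed form
    ([sum_vwp65]).  The summation formula is proved by induction on the
    terminating index [N]: the two sides satisfy the same first-order recurrence
    in [N], because the corresponding combination of the summands telescopes
    ([vwp65_contiguous]).

    Hence the limit has an explicit coefficient at each [X ^ (2 k)].  On the
    other side the three-term recurrence of the q-Lommel polynomials is solved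
    in closed form: the coefficient of [X ^ (m - 2 j)] in [h_m] is
    [(- c)^j q^(j (j - 1)) [m - j choose j]_q (c; q)_(m - j)
      / ((c; q)_j (c; q)_m)], which follows from the two q-Pascal rules
    ([qlommel_explicit]).  The two expressions agree for [m = 2 n + d] and
    [j = n - k] ([limit_coef_lommel]). *)

Set Implicit Arguments.
Unset Strict Implicit.
Unset Printing Implicit Defensive.

Import Order.TTheory GRing.Theory Num.Theory.
Import numFieldTopology.Exports numFieldNormedType.Exports.

Local Open Scope ring_scope.

(* [field] leaves one conjunction of nonvanishing conditions, whose conjuncts
   are expected among the hypotheses. *)
Ltac fieldnz := field; rewrite ?oner_eq0 /=; repeat (apply/andP; split=> //).

(** * Finite q-Pochhammer products *)

Section Pochhammer.
Variable K : fieldType.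
Implicit Types a b c d q v : K.

Lemma qpoch0 a q : qpoch a q 0 = 1.
Proof. by rewrite /qpoch big_ord0. Qed.

Lemma qpochS a q n : qpoch a q n.+1 = qpoch a q n * (1 - a * q ^+ n).
Proof. by rewrite /qpoch big_ord_recr. Qed.

Lemma qpochD a q m n :
  qpoch a q (m + n) = qpoch a q m * qpoch (a * q ^+ m) q n.
Proof.
elim: n => [|n IHn]; first by rewrite addn0 qpoch0 mulr1.
by rewrite addnS !qpochS IHn -!mulrA -exprD.
Qed.

Lemma qpochSl a q n : qpoch a q n.+1 = (1 - a) * qpoch (a * q) q n.
Proof. by rewrite -add1n qpochD qpochS qpoch0 mul1r expr0 mulr1 expr1. Qed.

Lemma qpoch_neq0 a q n :
  (forall i, (i < n)%N -> a * q ^+ i != 1) -> qpoch a q n != 0.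
Proof.
move=> nz; apply/prodf_neq0 => i _.
by rewrite subr_eq0 eq_sym; apply: nz.
Qed.

Lemma qpoch_neq0W a q m n : (m <= n)%N -> qpoch a q n != 0 -> qpoch a q m != 0.
Proof. by move=> /subnKC<-; rewrite qpochD mulf_eq0 negb_or => /andP[]. Qed.

Lemma qpoch_eq0 q n : q != 0 -> qpoch (q ^- n) q n.+1 = 0.
Proof. by move=> nz; rewrite qpochS mulVf ?expf_neq0 // subrr mulr0. Qed.

Lemma qpochs_nil q n : qpochs [::] q n = 1 :> K.
Proof. by rewrite /qpochs big_nil. Qed.

Lemma qpochs_cons a (s : seq K) q n :
  qpochs (a :: s) q n = qpoch a q n * qpochs s q n.
Proof. by rewrite /qpochs big_cons. Qed.

(** Each factor [1 - q^(i - N)] is [- q^(i - N)] times a factor of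
    [(q; q)_N]. *)
Lemma qpoch_reverse q N s : q != 0 -> (forall j, q ^+ j.+1 != 1) ->
  (s <= N)%N ->
  qpoch (q ^- N) q s =
    (- 1) ^+ s * q ^+ 'C(s, 2) / q ^+ (N * s) * qpoch q q N / qpoch q q (N - s).
Proof.
move=> nz gen.
have Q n : qpoch q q n != 0 by apply: qpoch_neq0 => i _; rewrite -exprS.
elim: s => [|s IHs] ltsN.
  by rewrite qpoch0 muln0 subn0 !expr0 divr1 !mul1r divff.
rewrite qpochS IHs ?(ltnW ltsN) // binS bin1 mulnS !exprS !exprD.
have := Q (N - s)%N; have := Q (N - s.+1)%N.
rewrite -(subnSK ltsN) qpochS -exprS subnSK // => h1.
rewrite mulf_eq0 negb_or => /andP[_ h2].
have e : q ^+ N = q ^+ (N - s) * q ^+ s by rewrite -exprD subnK // ltnW.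
rewrite mulnC exprM e; move: h2.
have nzs := expf_neq0 s nz; have nzr := expf_neq0 (N - s) nz.
have nzm : (q ^+ s) ^+ N != 0 by rewrite !expf_neq0.
move: nzs nzr nzm; move: (_ ^+ s) (q ^+ s) (q ^+ (N - s)) => u v w.
move=> *; fieldnz.
Qed.

End Pochhammer.

(** * The terminating very-well-poised 6W5 sum *)

Section WellPoised.
Variable K : fieldType.
Implicit Types a b c d q v : K.

(** The summand of index [s] of the very-well-poised series
    [6W5 (a; b, c, d; q, a q / (b c d))], whose argument is the one for which
    the series has a closed form. *)
Definition vwp65 a b c d q s : K :=
  (1 - a * q ^+ (2 * s)) / (1 - a) *
  (qpoch a q s * qpoch b q s * qpoch c q s * qpoch d q s /
   (qpoch q q s * qpoch (a * q / b) q s * qpoch (a * q / c) q s *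
    qpoch (a * q / d) q s)) * (a * q / (b * c * d)) ^+ s.

(** For [d = q^-N], hence [v = a q^(N+1)], the expected closed form of the
    series is multiplied by [(1 - v) (1 - v / (b c))] and divided by
    [(1 - v / b) (1 - v / c)] when [N] increases by one; this dictates the
    coefficients of the two contiguous series.  The combination of their
    summands is the difference of consecutive values of the right-hand side (a
    Wilf--Zeilberger certificate), so it can be summed up to any [S], with [d]
    arbitrary.  The right-hand side contains [(d; q)_S], hence it vanishes as
    soon as [d] is [q^-N] with [N < S]. *)
Lemma vwp65_contiguous a b c d v q S :
  a != 0 -> b != 0 -> c != 0 -> d != 0 -> q != 0 -> a != 1 -> v = a * q / d ->
  qpoch q q S != 0 -> qpoch (a * q / b) q S != 0 ->
  qpoch (a * q / c) q S != 0 -> qpoch v q S.+1 != 0 ->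
  \sum_(s < S.+1) ((1 - v / b) * (1 - v / c) * vwp65 a b c (d / q) q s -
                   (1 - v) * (1 - v / (b * c)) * vwp65 a b c d q s) =
  v / (b * c) * (qpoch (a * q) q S * qpoch b q S.+1 * qpoch c q S.+1 *
                 qpoch d q S /
   (qpoch q q S * qpoch (a * q / b) q S * qpoch (a * q / c) q S *
    qpoch (v * q) q S)) * (v / (b * c)) ^+ S.
Proof.
move=> a0 b0 c0 d0 q0 a1 vE.
have a1' : 1 - a != 0 by rewrite subr_eq0 eq_sym.
have v0 : v != 0 by rewrite vE !mulf_neq0 ?invr_eq0.
have dE : d = a * q / v by rewrite vE; fieldnz.
elim: S => [|S IHS].
  move=> _ _ _ _; rewrite big_ord1 /vwp65 !qpochS !qpoch0 muln0 !expr0 vE.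
  by fieldnz.
move=> hq hb hc hv; rewrite big_ord_recr IHS ?(qpoch_neq0W _ hq)
  ?(qpoch_neq0W _ hb) ?(qpoch_neq0W _ hc) ?(qpoch_neq0W _ hv) //= {IHS}.
rewrite /vwp65.
have -> : a * q / (d / q) = v * q by rewrite vE; fieldnz.
have -> : a * q / (b * c * (d / q)) = v / (b * c) * q.
  by rewrite vE; fieldnz.
have -> : a * q / (b * c * d) = v / (b * c).
  by rewrite vE; fieldnz.
rewrite -vE [qpoch a q _]qpochSl [qpoch (d / q) _ _]qpochSl divfK //.
rewrite [qpoch v q S.+1]qpochSl.
move: hq hb hc hv; rewrite [qpoch v q S.+2]qpochSl.
rewrite ![qpoch _ q S.+2]qpochS ![qpoch _ q S.+1]qpochS.
rewrite !mulf_eq0 !negb_or.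
move=> /andP[hq1 hq2] /andP[hb1 hb2] /andP[hc1 hc2] /and3P[h1 h2 h3].
clear vE d0; subst d.
rewrite !exprMn mul2n -addnn exprD !exprS.
move: hq1 hq2 hb1 hb2 hc1 hc2 h1 h2 h3.
have: q ^+ S != 0 by rewrite expf_neq0.
move: (qpoch (a * q / b) _ _) (qpoch (a * q / c) _ _) => pab pac.
move: (qpoch (a * q / v) _ _) (qpoch (a * q) _ _) => pd pa.
move: (qpoch q _ _) (qpoch b _ _) (qpoch c _ _) (qpoch (v * q) _ _).
move=> pq pb pc pv.
move: (q ^+ S) ((v / (b * c)) ^+ S) => Q X *.
have dbE : b - a * q * Q != 0.
  suff -> : b - a * q * Q = b * (1 - a * q / b * Q) by rewrite mulf_neq0.
  by fieldnz.
have dcE : c - a * q * Q != 0.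
  suff -> : c - a * q * Q = c * (1 - a * q / c * Q) by rewrite mulf_neq0.
  by fieldnz.
by fieldnz.
Qed.

(** By induction on [N]: for [d = q^-N] and [S = N + 1] the right-hand side
    of the contiguous relation is zero, and the relation becomes a first-order
    recurrence in [N], satisfied by the product as well. *)
Lemma sum_vwp65 a b c q N :
  a != 0 -> b != 0 -> c != 0 -> q != 0 ->
  (forall i, a * q ^+ i != 1) -> (forall j, q ^+ j.+1 != 1) ->
  qpoch (a * q / b) q N != 0 -> qpoch (a * q / c) q N != 0 ->
  \sum_(s < N.+1) vwp65 a b c (q ^- N) q s =
  qpoch (a * q) q N * qpoch (a * q / (b * c)) q N /
  (qpoch (a * q / b) q N * qpoch (a * q / c) q N).
Proof.
move=> a0 b0 c0 q0 ga gq; have a1 : a != 1 by have := ga 0%N; rewrite mulr1.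
have a1' : 1 - a != 0 by rewrite subr_eq0 eq_sym.
have Q n : qpoch q q n != 0 by apply: qpoch_neq0 => i _; rewrite -exprS.
elim: N => [|N IHN].
  by rewrite big_ord1 /vwp65 !qpoch0 muln0 !expr0 => _ _; fieldnz.
move=> hb hc; set v := a * q ^+ N.+1.
have vE : v = a * q / q ^- N by rewrite invrK -mulrA -exprS.
have qN0 : q ^- N != 0 by rewrite invr_eq0 expf_neq0.
have hv n : qpoch v q n != 0.
  by apply: qpoch_neq0 => i _; rewrite -mulrA -exprD ga.
(* The summand of index N + 1 of the shorter series vanishes, so both series
   can be summed over the same range. *)
have := vwp65_contiguous a0 b0 c0 qN0 q0 a1 vE (Q _) hb hc (hv _).
rewrite qpoch_eq0 // !(mulr0, mul0r) sumrB -!mulr_sumr.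
have -> : q ^- N / q = q ^- N.+1 by rewrite -invfM exprSr.
rewrite [X in _ - _ * X = _]big_ord_recr /= [vwp65 a b c (q ^- N) q N.+1]/vwp65.
rewrite qpoch_eq0 // !(mulr0, mul0r) addr0 IHN ?(qpoch_neq0W _ hb)
  ?(qpoch_neq0W _ hc) // => /subr0_eq.
move: hb hc; rewrite !qpochS !mulf_eq0 !negb_or.
have -> : a * q / b * q ^+ N = v / b by rewrite /v exprS; fieldnz.
have -> : a * q / c * q ^+ N = v / c by rewrite /v exprS; fieldnz.
have -> : a * q / (b * c) * q ^+ N = v / (b * c) by rewrite /v exprS; fieldnz.
have -> : a * q * q ^+ N = v by rewrite -mulrA -exprS.
move=> /andP[hb1 hb2] /andP[hc1 hc2] e.
apply: (mulfI (mulf_neq0 hb2 hc2)); rewrite e.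
move: (qpoch (a * q / b) _ _) (qpoch (a * q / c) _ _) hb1 hc1 => u w u0 w0.
move: (qpoch (a * q) _ _) (qpoch (a * q / (b * c)) _ _) => x y.
have dbE : b - v != 0.
  by suff -> : b - v = b * (1 - v / b); rewrite ?mulf_neq0 //; fieldnz.
have dcE : c - v != 0.
  by suff -> : c - v = c * (1 - v / c); rewrite ?mulf_neq0 //; fieldnz.
by fieldnz.
Qed.

End WellPoised.

(** * Explicit q-Lommel polynomials *)

Section ExplicitLommel.
Variables (K : fieldType) (c q : K).
Hypothesis q0 : q != 0.
Hypothesis q_generic : forall j : nat, q ^+ j.+1 != 1.
Hypothesis c_generic : forall j : nat, c * q ^+ j != 1.

(** The Gaussian binomial coefficient; it must vanish for [m < j], so that
    sums over [j] need no sharp upper bound. *)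
Definition qbinom (m j : nat) : K :=
  if (j <= m)%N then qpoch q q m / (qpoch q q j * qpoch q q (m - j)) else 0.

(** The coefficient of [X^(m - 2 j)] in [h_m].  The exponent [j (j - 1)]
    of [q] is written as twice [C(j, 2)], which grows by [j] at each step. *)
Definition lommel_coef (m j : nat) : K :=
  (- c) ^+ j * (q ^+ 'C(j, 2)) ^+ 2 * qbinom (m - j) j *
  (qpoch c q (m - j) / (qpoch c q j * qpoch c q m)).

Lemma qq_neq0 n : qpoch q q n != 0.
Proof. by apply: qpoch_neq0 => i _; rewrite -exprS. Qed.

Lemma cq_neq0 n : qpoch c q n != 0.
Proof. by apply: qpoch_neq0 => i _. Qed.

(** The rule [[p+1, j+1] = [p, j+1] + q^(p-j) [p, j]] minus [c q^p] times
    the rule [[p+1, j+1] = q^(j+1) [p, j+1] + [p, j]].  This combination of the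
    two q-Pascal rules is what the recurrence of the q-Lommel coefficients
    amounts to. *)
Lemma qbinom_rec p j : qbinom p.+1 j.+1 * (1 - c * q ^+ p) =
  (1 - c * q ^+ (p + j).+1) * qbinom p j.+1 +
  q ^+ p / q ^+ j * (1 - c * q ^+ j) * qbinom p j.
Proof.
rewrite /qbinom ltnS; case: (ltngtP j p) => [ltjp|ltpj|<-]; last 1 first.
- rewrite !subnn !qpoch0 qpochS.
  have := qq_neq0 j; have := qq_neq0 j.+1.
  rewrite qpochS mulf_eq0 negb_or => /andP[_ h1] h.
  by have := expf_neq0 j q0 => ?; fieldnz.
- have [r ->] : exists r, p = (j + r).+1 by exists (p - j.+1)%N; lia.
  have -> : ((j + r).+2 - j.+1 = r.+1)%N by lia.
  have -> : ((j + r).+1 - j.+1 = r)%N by lia.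
  have -> : ((j + r).+1 - j = r.+1)%N by lia.
  have hj := qq_neq0 j; have hj1 := qq_neq0 j.+1.
  have hr := qq_neq0 r; have hr1 := qq_neq0 r.+1.
  move: hj1 hr1; rewrite qpochS mulf_eq0 negb_or => /andP[_ hj1].
  rewrite qpochS mulf_eq0 negb_or => /andP[_ hr1].
  rewrite !qpochS !addSn.
  have := expf_neq0 j q0.
  move: hj hj1 hr hr1; rewrite !(exprS, exprD).
  move: (qpoch _ _ _) (qpoch _ _ _) (qpoch _ _ _) => u v w.
  by move: (q ^+ j) (q ^+ r) => x y *; fieldnz.
- by rewrite !mulr0 mul0r addr0.
Qed.

Lemma qbinom0 m : qbinom m 0 = 1.
Proof. by rewrite /qbinom subn0 qpoch0 mul1r divff ?qq_neq0. Qed.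

Lemma qbinom_gt m j : (m < j)%N -> qbinom m j = 0.
Proof. by rewrite /qbinom ltnNge => /negbTE->. Qed.

Lemma lommel_coef0 m : lommel_coef m 0 = 1.
Proof.
rewrite /lommel_coef subn0 qbinom0 qpoch0 !expr0 expr1n !mul1r.
by rewrite divff ?cq_neq0.
Qed.

Lemma lommel_coef_gt m j : (m < 2 * j)%N -> lommel_coef m j = 0.
Proof.
move=> lt; rewrite /lommel_coef qbinom_gt ?mulr0 ?mul0r //; lia.
Qed.

Lemma lommel_coefS m j : lommel_coef m.+2 j.+1 =
  lommel_coef m.+1 j.+1 - qlommel_lambda c q m.+1 * lommel_coef m j.
Proof.
case: (leqP j m) => [lejm|ltmj]; last first.
  by rewrite !lommel_coef_gt ?mulr0 ?subr0 // mul2n -addnn; lia.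
have e1 : (m.+2 - j.+1 = (m - j).+1)%N by lia.
have e2 : (m.+1 - j.+1 = m - j)%N by lia.
rewrite /lommel_coef /qlommel_lambda e1 e2 intS [1 + _]addrC addrK -exprnP.
have := qbinom_rec (m - j) j; rewrite subnK // => rec.
have := cq_neq0 m.+2; rewrite [qpoch c q m.+2]qpochS [qpoch c q m.+1]qpochS.
have := cq_neq0 j.+1; rewrite [qpoch c q j.+1]qpochS.
rewrite [qpoch c q (m - j).+1]qpochS binS bin1 exprD !exprS.
have Qm : q ^+ m = q ^+ (m - j) * q ^+ j by rewrite -exprD subnK.
rewrite !mulf_eq0 !negb_or => /andP[hj1 hj2] /andP[/andP[hm1 hm2] hm3].
have nzj := expf_neq0 j q0; have nzr := expf_neq0 (m - j) q0.
have {rec} -> : qbinom (m - j).+1 j.+1 =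
    ((1 - c * q ^+ m.+1) * qbinom (m - j) j.+1 +
     q ^+ (m - j) / q ^+ j * (1 - c * q ^+ j) * qbinom (m - j) j) /
    (1 - c * q ^+ (m - j)).
  by rewrite -rec mulfK // subr_eq0 eq_sym.
have hp : 1 - c * q ^+ (m - j) != 0 by rewrite subr_eq0 eq_sym.
move: hj1 hj2 hm1 hm2 hm3 nzj nzr hp; rewrite !exprS Qm.
move: (q ^+ 'C(j, 2)) ((- c) ^+ j) (qbinom _ _) (qbinom _ _) => x y u w.
move: (qpoch _ _ _) (qpoch _ _ _) (qpoch _ _ _) (q ^+ j) (q ^+ (m - j)).
move=> *; fieldnz.
Qed.

Lemma qlommelSS m :
  qlommel c q m.+2 =
  'X * qlommel c q m.+1 - qlommel_lambda c q m.+1 *: qlommel c q m.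
Proof.
by rewrite /qlommel /=; case: (qlommel_pair c q m) => hp h.
Qed.

Lemma qlommel1 : qlommel c q 1 = 'X.
Proof. by rewrite /qlommel /= mulr1 scaler0 subr0. Qed.

(** The recurrence relates coefficients with the same [m - 2 j], which is
    [lommel_coefS].  Any [S > m / 2] is allowed since the coefficients vanish
    beyond [m / 2]; this makes the induction, which lowers [S] and [m] together,
    uniform in the parity of [m]. *)
Lemma qlommel_explicit m S : (m < 2 * S)%N ->
  qlommel c q m = \sum_(j < S) lommel_coef m j *: 'X^(m - 2 * j).
Proof.
elim/ltn_ind: m S => -[|[|m]] IHm [|S] ltmS; rewrite ?muln0 // in ltmS *.
- rewrite big_ord_recl big1 ?addr0 => [|j _].
    by rewrite lommel_coef0 muln0 scale1r expr0 /qlommel.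
  by rewrite lommel_coef_gt ?scale0r // mul2n -addnn lift0; lia.
- rewrite big_ord_recl big1 ?addr0 => [|j _].
    by rewrite lommel_coef0 muln0 scale1r expr1 qlommel1.
  by rewrite lommel_coef_gt ?scale0r // mul2n -addnn lift0; lia.
rewrite qlommelSS (IHm m.+1 _ S.+1) ?(IHm m _ S) //; try lia.
rewrite !big_ord_recl !lommel_coef0 muln0 !subn0 !scale1r mulrDr -exprS.
rewrite -addrA mulr_sumr scaler_sumr -sumrB; congr (_ + _).
apply: eq_bigr => j _; rewrite !lift0 scalerA lommel_coefS scalerBl.
have -> : (m.+2 - 2 * j.+1 = m - 2 * j)%N by lia.
congr (_ - _); have [lt|le] := ltnP m.+1 (2 * j.+1).
  by rewrite lommel_coef_gt // !scale0r mulr0.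
rewrite -scalerAr -exprS; congr (_ *: 'X^_); lia.
Qed.

End ExplicitLommel.

(** * Coefficientwise limits at infinity *)

Section LimitsAtInfinity.
Local Open Scope classical_set_scope.
Variable K : numFieldType.
Local Notation oo := (@at_infty K).

Lemma near_infty_neq0 : \forall a \near oo, a != 0.
Proof.
exists 0; first exact: real0.
by move=> a /=; rewrite normr_gt0.
Qed.

Lemma cvg_infty_inv : (fun a : K => a^-1) @ oo --> (0 : K).
Proof.
apply/cvgrPdist_lt => e e0; exists e^-1; first by rewrite /= realE invr_ge0 ltW.
move=> a /= lta; rewrite sub0r normrN normfV invf_plt ?posrE //.
by rewrite (lt_trans _ lta) // invr_gt0.
Qed.

Lemma cvg_near (f g : K -> K) (l : K) :
  (\forall a \near oo, f a = g a) -> g @ oo --> l -> f @ oo --> l.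
Proof.
move=> eqfg; apply: cvg_trans; apply: near_eq_cvg.
by apply: filterS eqfg => a ->.
Qed.

Lemma coef_lim_near (P Q : K -> {poly K}) L :
  (\forall a \near oo, P a = Q a) -> coef_lim_infty Q L -> coef_lim_infty P L.
Proof.
move=> eqPQ limQ i; apply: cvg_trans (limQ i).
by apply: near_eq_cvg; apply: filterS eqPQ => a ->.
Qed.

Lemma coef_lim_cst (p : {poly K}) : coef_lim_infty (fun=> p) p.
Proof. by move=> i; apply: cvg_cst. Qed.

Lemma coef_limD (P Q : K -> {poly K}) L M :
  coef_lim_infty P L -> coef_lim_infty Q M ->
  coef_lim_infty (fun a => P a + Q a) (L + M).
Proof.
move=> limP limQ i; rewrite coefD; under eq_fun do rewrite coefD.
exact: cvgD.
Qed.

Lemma cvg_big_sum (I : Type) (r : seq I) (F : I -> K -> K) (l : I -> K) :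
  (forall i, F i @ oo --> l i) ->
  (fun a => \sum_(i <- r) F i a) @ oo --> \sum_(i <- r) l i.
Proof.
move=> limF; elim: r => [|i r IHr].
  by under eq_fun do rewrite big_nil; rewrite big_nil; apply: cvg_cst.
under eq_fun do rewrite big_cons; rewrite big_cons; exact: cvgD.
Qed.

Lemma coef_limM (P Q : K -> {poly K}) L M :
  coef_lim_infty P L -> coef_lim_infty Q M ->
  coef_lim_infty (fun a => P a * Q a) (L * M).
Proof.
move=> limP limQ i; rewrite coefM; under eq_fun do rewrite coefM.
by apply: cvg_big_sum => j; apply: cvgM.
Qed.

Lemma coef_limC (f : K -> K) (l : K) : f @ oo --> l ->
  coef_lim_infty (fun a => (f a)%:P) l%:P.
Proof.
move=> limf i; rewrite coefC; under eq_fun do rewrite coefC.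
by case: (i == 0)%N => //; apply: cvg_cst.
Qed.

Lemma coef_limZ (f : K -> K) (P : K -> {poly K}) (l : K) L :
  f @ oo --> l -> coef_lim_infty P L ->
  coef_lim_infty (fun a => f a *: P a) (l *: L).
Proof.
move=> limf limP i; rewrite coefZ; under eq_fun do rewrite coefZ.
exact: cvgM.
Qed.

Lemma coef_lim_sum n (P : 'I_n -> K -> {poly K}) L :
  (forall i, coef_lim_infty (P i) (L i)) ->
  coef_lim_infty (fun a => \sum_(i < n) P i a) (\sum_(i < n) L i).
Proof.
move=> limP i; rewrite coef_sum; under eq_fun do rewrite coef_sum.
by apply: cvg_big_sum => j; apply: limP.
Qed.

Lemma coef_lim_prod n (P : nat -> K -> {poly K}) L :
  (forall i, coef_lim_infty (P i) (L i)) ->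
  coef_lim_infty (fun a => \prod_(i < n) P i a) (\prod_(i < n) L i).
Proof.
move=> limP; elim: n => [|n IHn].
  rewrite big_ord0; under eq_fun do rewrite big_ord0; exact: coef_lim_cst.
rewrite big_ord_recr; under eq_fun do rewrite big_ord_recr; exact: coef_limM.
Qed.

Variable q : K.

(** The normalisation of [(b a; q)_n] that has a finite limit, nonzero
    for [b != 0], as [a] tends to infinity. *)
Definition qpoch_scaled (b : K) n (a : K) : K := a ^- n * qpoch (b * a) q n.

Lemma cvg_qpoch_scaled b n :
  qpoch_scaled b n @ oo --> (- b) ^+ n * q ^+ 'C(n, 2).
Proof.
elim: n => [|n IHn].
  rewrite /qpoch_scaled; under eq_fun do rewrite qpoch0 expr0 invr1 mulr1.
  by rewrite !mulr1; apply: cvg_cst.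
have step : (fun a => qpoch_scaled b n a * (a^-1 - b * q ^+ n)) @ oo -->
   (- b) ^+ n * q ^+ 'C(n, 2) * (0 - b * q ^+ n).
  by apply: cvgM => //; apply: cvgB; [exact: cvg_infty_inv|exact: cvg_cst].
have -> : (- b) ^+ n.+1 * q ^+ 'C(n.+1, 2) =
  (- b) ^+ n * q ^+ 'C(n, 2) * (0 - b * q ^+ n).
  by rewrite binS bin1 exprS exprD; ring.
apply: cvg_near step; apply: filterS near_infty_neq0 => a a0.
rewrite /qpoch_scaled qpochS exprS.
by have := expf_neq0 n a0; move: (a ^+ n) => x x0; fieldnz.
Qed.

Lemma cvg_qpoch_vanishing b n : (fun a => qpoch (b / a) q n) @ oo --> (1 : K).
Proof.
elim: n => [|n IHn].
  by under eq_fun do rewrite qpoch0; apply: cvg_cst.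
under eq_fun do rewrite qpochS.
have : (fun a => qpoch (b / a) q n * (1 - b / a * q ^+ n)) @ oo -->
  1 * (1 - b * 0 * q ^+ n).
  apply: cvgM => //; apply: cvgB; first exact: cvg_cst.
  apply: cvgM; last exact: cvg_cst.
  by apply: cvgM; [exact: cvg_cst|exact: cvg_infty_inv].
by rewrite mulr0 mul0r subr0 mulr1.
Qed.

End LimitsAtInfinity.

(** * Removing the powers of alpha *)

Section Rescaled.
Variables (K : numFieldType) (c q : K) (eps : aw_type) (n : nat).
Hypothesis q0 : q != 0.

(** The parameter [d] on which the two limits depend: it enters through
    [B = q^(d+1) / alpha^2] and through the argument [q^(1 - d)] of the inner
    series. *)
Definition aw_shift : nat := if eps is Eps1 then 1 else 0.
Local Notation d := aw_shift.

Definition rescaled_basis (k : nat) (a : K) : {poly K} :=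
  \prod_(i < k) (((1 + q ^+ (2 * i)) / a ^+ 2)%:P + (q ^+ i / q ^+ d) *: 'X^2).

(** What remains of the prefactor [K_n] and of the coefficient of index [k]
    of the outer sum once the powers of [a] have been moved into the factors
    [qpoch_scaled]. *)
Definition rescaled_coef (k : nat) (a : K) : K :=
  (- q ^+ d) ^+ n *
  (qpoch (q ^+ d.+1 / a) q n * qpoch_scaled q c n a * qpoch_scaled q 1 n a *
   qpoch (c * q ^+ d / a) q n) /
  (qpoch (c * q ^+ (n + d)) q n * qpoch (c * q ^+ d) q n) *
  (qpoch (q ^- n) q k * qpoch (c * q ^+ (n + d)) q k * qpoch (c * q ^+ d) q k /
   (qpoch q q k *
   (qpoch (q ^+ d.+1 / a) q k * qpoch_scaled q c k a * qpoch_scaled q 1 k a *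
    qpoch (c * q ^+ d / a) q k))) * q ^+ k.

(** The base parameter [ABCD alpha^2 q^(k-2)] of [W_k].  The exponent is an
    integer because it is [-1] for [k = d = 0]. *)
Definition inner_base (k : nat) : K := c * q ^ ((k + d)%:Z - 1).

Definition rescaled_series (k : nat) (a : K) : K :=
  W109 (inner_base k)
    [tuple a; c * q ^+ d / a; q ^+ d / a; c / q * a; q ^+ (k + d);
           c * q ^+ (n + k + d); q ^- (n - k)]
    q (q / q ^+ d) (n - k).

Lemma aw_basis_rescaled k a : a != 0 ->
  aw_basis 1 q k \Po (- (a ^+ 2 / (2 * q ^+ d)) *: 'X^2) =
  a ^+ (2 * k) *: rescaled_basis k a.
Proof.
move=> a0; rewrite /aw_basis /rescaled_basis.
have n2 : 2 != 0 :> K by rewrite pnatr_eq0.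
have qd0 := expf_neq0 d q0.
elim: k => [|k IHk]; first by rewrite !big_ord0 scale1r -polyC1 comp_polyC.
rewrite !big_ord_recr comp_polyM {}IHk -scalerAl mulnS addnC exprD.
rewrite -[in RHS]scalerA [in RHS]scalerAr /=; congr (_ *: (_ * _)).
rewrite mulr1 mul1r comp_polyD comp_polyB comp_polyZ comp_polyX -polyC1.
rewrite !comp_polyC scalerDr -[_ *: _%:P]mul_polyC -polyCM !scalerA.
rewrite -scaleNr addrAC -polyCD -exprM mulnC.
by congr (_%:P + _ *: _); fieldnz.
Qed.

Lemma inner_baseE k a : a != 0 ->
  1 * (q ^+ d.+1 / a ^+ 2) * c * 1 * a ^+ 2 * q ^ (k%:Z - 2) = inner_base k.
Proof.
move=> a0; rewrite /inner_base.
have -> : ((k + d)%:Z - 1 = k%:Z - 2 + d.+1%:Z)%R by lia.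
rewrite [in RHS]expfzDr // -[q ^ d.+1%:Z]exprnP; move: (q ^ _) => x.
by rewrite exprS; fieldnz.
Qed.

Lemma inner_baseS m a : a != 0 ->
  1 * (q ^+ d.+1 / a ^+ 2) * c * 1 * a ^+ 2 * q ^ (m%:Z - 1) = c * q ^+ (m + d).
Proof.
move=> a0.
have -> : (m%:Z - 1 = m.+1%:Z - 2)%R by lia.
rewrite inner_baseE // /inner_base.
by have -> : ((m.+1 + d)%N%:Z - 1 = (m + d)%N%:Z)%R by lia.
Qed.

Lemma expz_sub m : (m <= n)%N -> q ^ (m%:Z - n%:Z) = q ^- (n - m).
Proof.
move=> le; have -> : (m%:Z - n%:Z = - (n - m)%N%:Z)%R by lia.
by rewrite -exprnN.
Qed.

(** Holds for every nonzero [a]: the powers [a^(-2 n)], [a^n] (twice),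
    [a^(-k)] (twice) and [a^(2 k)], extracted from the scale, from [K_n], from
    the coefficients and from the basis, cancel.  Inverses of Pochhammer
    symbols are only moved around, which is sound even where one vanishes. *)
Lemma assocAW_rescaled a : a != 0 ->
  ((- 2 * q ^+ d) ^+ n / a ^+ (2 * n)) *:
    (assocAW eps 1 (q ^+ d.+1 / a ^+ 2) c 1 a q n
       \Po (- (a ^+ 2 / (2 * q ^+ d)) *: 'X^2)) =
  \sum_(k < n.+1) (rescaled_coef k a * rescaled_series k a) *:
     rescaled_basis k a.
Proof.
move=> a0; rewrite /assocAW comp_polyZ scalerA.
rewrite raddf_sum scaler_sumr; apply: eq_bigr => k _ /=.
rewrite comp_polyZ aw_basis_rescaled // !scalerA; congr (_ *: _).
rewrite !inner_baseE //.
rewrite -PoszD !inner_baseS // expz_sub; last by rewrite -ltnS.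
have -> : 1 * (q ^+ d.+1 / a ^+ 2) * c * 1 * a ^+ 2 / q = c * q ^+ d.
  by rewrite exprS; fieldnz.
have -> : 1 * (q ^+ d.+1 / a ^+ 2) * a = q ^+ d.+1 / a by fieldnz.
have -> : 1 * (q ^+ d.+1 / a ^+ 2) * c * 1 * a / q = c * q ^+ d / a.
  by rewrite exprS; fieldnz.
have -> : q ^+ d.+1 / a ^+ 2 * c * a / q = c * q ^+ d / a.
  by rewrite exprS; fieldnz.
have -> : q ^+ d.+1 / a ^+ 2 * 1 * a / q = q ^+ d / a.
  by rewrite exprS; fieldnz.
have -> : c * 1 * a / q = c / q * a by fieldnz.
rewrite /rescaled_series !mul1r.
set W := (let: (_, _) := _ in _).
set W' := W109 _ _ _ _ _.
have -> : W = W'.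
  rewrite {}/W {}/W' /aw_shift; case: eps.
    by rewrite expr1n !addn1 expr1 divff.
  by rewrite expr0 expr1n divr1 !mulr1 !addn0.
rewrite -mulrA (mulrAC _ W') mulrA; congr (_ * _).
rewrite /rescaled_coef /qpoch_scaled !(qpochs_cons, qpochs_nil, mulr1) !mul1r.
rewrite mulNr (exprNn (2 * _)) (exprNn (q ^+ d)) (exprMn _ 2).
rewrite !mul2n -!addnn (exprD a n) (exprD a k).
have t0 : 2 ^+ n != 0 :> K by rewrite expf_neq0 // pnatr_eq0.
move: (expf_neq0 n a0) (expf_neq0 k a0) t0.
move: (a ^+ n) (a ^+ k) (2 ^+ n : K) => A B T A0 B0 T0.
do 6! [move: (qpoch _ q n) => ?]; do 8! [move: (qpoch _ q k) => ?].
rewrite !invfM !invrK.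
(* Inverses of Pochhammer symbols, which may be zero, become variables. *)
repeat match goal with |- context [GRing.inv ?x] =>
  lazymatch goal with
  | _ : is_true (x != 0) |- _ => fail
  | _ => move: (x^-1) => ?
  end end.
by fieldnz.
Qed.

End Rescaled.

(** * The termwise limit *)

Section RescaledLimits.
Local Open Scope classical_set_scope.
Variables (K : numFieldType) (c q : K) (eps : aw_type) (n : nat).
Local Notation oo := (@at_infty K).
Hypothesis c0 : c != 0.
Hypothesis q0 : q != 0.
Local Notation d := (aw_shift eps).

Lemma cvg_qpoch_ratio (a b : K) s : b != 0 ->
  (fun x => qpoch (a * x) q s / qpoch (b * x) q s) @ oo --> (a / b) ^+ s.
Proof.
move=> b0; have lim_nz : (- b) ^+ s * q ^+ 'C(s, 2) != 0.
  by rewrite mulf_neq0 ?expf_neq0 ?oppr_eq0.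
have := cvgM (@cvg_qpoch_scaled _ q a s)
  (cvgV lim_nz (@cvg_qpoch_scaled _ q b s)).
have -> : (- a) ^+ s * q ^+ 'C(s, 2) / ((- b) ^+ s * q ^+ 'C(s, 2)) =
    (a / b) ^+ s.
  rewrite -mulf_div divff ?expf_neq0 // mulr1 -expr_div_n.
  by congr (_ ^+ s); fieldnz.
move=> h; apply: (cvg_near _ (h _ _)).
apply: filterS (near_infty_neq0 K) => x x0.
have xs := expf_neq0 s x0; rewrite /qpoch_scaled /= invfM invrK.
by move: (qpoch (b * x) _ _)^-1 => y; fieldnz.
Qed.

Lemma inner_baseM k : inner_base c q eps k * q = c * q ^+ (k + d).
Proof.
rewrite /inner_base -mulrA; congr (_ * _).
by rewrite -[q in _ * q]expr1z -expfzDr // subrK.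
Qed.

Definition inner_term k s : K :=
  vwp65 (inner_base c q eps k) (q ^+ (k + d)) (c * q ^+ (n + k + d))
    (q ^- (n - k)) q s.

(** The four parameters depending on [a] pair up with four denominators:
    [(a)_s / (q^k a)_s] tends to [q^(-k s)], [(c a / q)_s / (c q^k a)_s] tends
    to [q^(-(k + 1) s)], and the factors in [1 / a] tend to [1].  The resulting
    power [q^(1 - d - 2 k - 1)] is the argument of the summable 6W5 series. *)
Lemma cvg_rescaled_series k : (k <= n)%N ->
  rescaled_series c q eps n k @ oo --> \sum_(s < (n - k).+1) inner_term k s.
Proof.
move=> lekn; rewrite /rescaled_series /W109; apply: cvg_big_sum => -[s /= _].
set u := inner_base _ _ _ _; set b := q ^+ (k + d).
set c' := c * q ^+ (n + k + d); set d' := q ^- _; set t := q / _.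
have qk0 := expf_neq0 k q0; have qd0 := expf_neq0 d q0.
have uq : u * q = c * (q ^+ k * q ^+ d) by rewrite inner_baseM exprD.
pose C := (1 - u * q ^+ (2 * s)) / (1 - u) *
  (qpoch u q s * qpoch b q s * qpoch c' q s * qpoch d' q s /
   (qpoch q q s * qpoch (u * q / b) q s * qpoch (u * q / c') q s *
    qpoch (u * q / d') q s)).
pose g a := C * (qpoch (c * q ^+ d / a) q s * qpoch (q ^+ d / a) q s /
    (qpoch (u * q / a) q s * qpoch (q ^+ k * q ^+ d * q / a) q s)) *
  (qpoch (1 * a) q s / qpoch (q ^+ k * a) q s) *
  (qpoch (c / q * a) q s / qpoch (c * q ^+ k * a) q s) * t ^+ s.
apply: (cvg_near (g := g)).
  apply: filterS (near_infty_neq0 K) => a a0.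
  rewrite !(qpochs_cons, qpochs_nil, mulr1) /g mul1r.
  have -> : u * q / (c * q ^+ d / a) = q ^+ k * a by rewrite uq; fieldnz.
  have -> : u * q / (q ^+ d / a) = c * q ^+ k * a by rewrite uq; fieldnz.
  have -> : u * q / (c / q * a) = q ^+ k * q ^+ d * q / a.
    by rewrite uq; fieldnz.
  congr (_ * _); rewrite /C.
  (* An identity between monomials in Pochhammer symbols and inverses, valid
     even where some denominators are zero. *)
  do 16! [move: (qpoch _ _ _) => ?]; rewrite !invfM.
  repeat match goal with |- context [GRing.inv ?x] => move: (x^-1) => ? end.
  by ring.
have lim1 : g @ oo --> C * (1 * 1 / (1 * 1)) * (1 / q ^+ k) ^+ s *
    (c / q / (c * q ^+ k)) ^+ s * t ^+ s.
  have n1 : 1 * 1 != 0 :> K by rewrite mulr1 oner_eq0.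
  apply: cvgM; last exact: cvg_cst.
  apply: cvgM; last by apply: cvg_qpoch_ratio; rewrite mulf_neq0.
  apply: cvgM; last exact: cvg_qpoch_ratio.
  apply: cvgM; first exact: cvg_cst.
  apply: cvgM; first by apply: cvgM; apply: cvg_qpoch_vanishing.
  by apply: cvgV => //; apply: cvgM; apply: cvg_qpoch_vanishing.
suff <- : C * (1 * 1 / (1 * 1)) * (1 / q ^+ k) ^+ s *
    (c / q / (c * q ^+ k)) ^+ s * t ^+ s = inner_term k s by [].
rewrite /inner_term /vwp65 -/u -/b -/c' -/d' !mulr1 divff ?oner_eq0 //.
rewrite mulr1.
rewrite -(mulrA (C * _)) -(mulrA C) -!exprMn; congr (_ * _ ^+ s).
rewrite uq /b /c' /d' /t !exprD.
have -> : q ^+ n = q ^+ (n - k) * q ^+ k by rewrite -exprD subnK.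
have := expf_neq0 (n - k) q0; move: (q ^+ (n - k)) => x x0.
by fieldnz.
Qed.

(** Written with the trivial factors [1] in the places of the factors that
    tend to [1], so that it matches [rescaled_coef] factor by factor. *)
Definition limit_coef k : K :=
  (- q ^+ d) ^+ n *
  (1 * ((- c) ^+ n * q ^+ 'C(n, 2)) * ((- 1) ^+ n * q ^+ 'C(n, 2)) * 1) /
  (qpoch (c * q ^+ (n + d)) q n * qpoch (c * q ^+ d) q n) *
  (qpoch (q ^- n) q k * qpoch (c * q ^+ (n + d)) q k * qpoch (c * q ^+ d) q k /
   (qpoch q q k *
   (1 * ((- c) ^+ k * q ^+ 'C(k, 2)) * ((- 1) ^+ k * q ^+ 'C(k, 2)) * 1))) *
  q ^+ k.

Lemma cvg_rescaled_coef k : (forall j, q ^+ j.+1 != 1) ->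
  rescaled_coef c q eps n k @ oo --> limit_coef k.
Proof.
move=> gen.
have lim m : (fun a => qpoch (q ^+ d.+1 / a) q m * qpoch_scaled q c m a *
     qpoch_scaled q 1 m a * qpoch (c * q ^+ d / a) q m) @ oo -->
  1 * ((- c) ^+ m * q ^+ 'C(m, 2)) * ((- 1) ^+ m * q ^+ 'C(m, 2)) * 1.
  apply: cvgM; last exact: cvg_qpoch_vanishing.
  apply: cvgM; last exact: cvg_qpoch_scaled.
  apply: cvgM; last exact: cvg_qpoch_scaled.
  exact: cvg_qpoch_vanishing.
rewrite /rescaled_coef /limit_coef.
apply: cvgM; last exact: cvg_cst.
apply: cvgM.
  apply: cvgM; last exact: cvg_cst.
  by apply: cvgM; [exact: cvg_cst|exact: lim].
apply: cvgM; first exact: cvg_cst.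
apply: cvgV; last by apply: cvgM; [exact: cvg_cst|exact: lim].
rewrite mulr1 mul1r !mulf_neq0 ?expf_neq0 ?oppr_eq0 ?oner_eq0 //.
by apply: qpoch_neq0 => i _; rewrite -exprS.
Qed.

Lemma coef_lim_rescaled_basis k :
  coef_lim_infty (rescaled_basis q eps k)
    (q ^+ 'C(k, 2) / (q ^+ d) ^+ k *: 'X^(2 * k)).
Proof.
(* The product 0 * 0 stands for the limit of a^-1 * a^-1. *)
have -> : q ^+ 'C(k, 2) / (q ^+ d) ^+ k *: 'X^(2 * k) =
  \prod_(i < k) (((1 + q ^+ (2 * i)) * (0 * 0))%:P +
                   (q ^+ i / q ^+ d) *: 'X^2) :> {poly K}.
  elim: k => [|k IHk].
    by rewrite big_ord0 muln0 !expr0 divr1 scale1r.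
  rewrite big_ord_recr -IHk /= !mulr0 polyC0 add0r -scalerAr -scalerAl scalerA.
  rewrite -exprD binS bin1 exprD exprS invfM.
  congr (_ *: 'X^_); last lia.
  by move: (_^-1) (_^-1) => x y; ring.
apply: (@coef_lim_prod _ _
  (fun i a => ((1 + q ^+ (2 * i)) / a ^+ 2)%:P + (q ^+ i / q ^+ d) *: 'X^2)
  (fun i => ((1 + q ^+ (2 * i)) * (0 * 0))%:P + (q ^+ i / q ^+ d) *: 'X^2)).
move=> i.
apply: coef_limD; last exact: coef_lim_cst.
apply: coef_limC; under eq_fun do rewrite expr2 invfM.
by apply: cvgM; [exact: cvg_cst|apply: cvgM; exact: cvg_infty_inv].
Qed.

Lemma coef_lim_assocAW : (forall j, q ^+ j.+1 != 1) ->
  coef_lim_infty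
    (fun a => ((- 2 * q ^+ d) ^+ n / a ^+ (2 * n)) *:
      (assocAW eps 1 (q ^+ d.+1 / a ^+ 2) c 1 a q n
         \Po (- (a ^+ 2 / (2 * q ^+ d)) *: 'X^2)))
    (\sum_(k < n.+1) (limit_coef k * \sum_(s < (n - k).+1) inner_term k s) *:
       (q ^+ 'C(k, 2) / (q ^+ d) ^+ k *: 'X^(2 * k))).
Proof.
move=> gen; apply: coef_lim_near.
  by apply: filterS (near_infty_neq0 K) => a a0; apply: assocAW_rescaled.
apply: coef_lim_sum => k; apply: coef_limZ; last exact: coef_lim_rescaled_basis.
apply: cvgM; first exact: cvg_rescaled_coef.
by apply: cvg_rescaled_series; rewrite -ltnS.
Qed.

End RescaledLimits.

(** * Identification of the limit *)

Lemma bin2D k r : ('C(k + r, 2) = 'C(k, 2) + 'C(r, 2) + k * r)%N.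
Proof.
elim: r => [|r IHr]; first by rewrite addn0 muln0 !addn0.
by rewrite addnS !binS !bin1 IHr mulnS; lia.
Qed.

Lemma sqrn_bin2 k : (k * k = 'C(k, 2) + 'C(k, 2) + k)%N.
Proof. by elim: k => // k IHk; rewrite binS bin1 mulnS mulSn IHk; lia. Qed.

Lemma c_generic_nat (K : fieldType) (c q : K) :
  (forall j : nat, c * q ^ (j%:Z - 1) != 1) -> forall j, c * q ^+ j != 1.
Proof.
move=> gen j; have := gen j.+1.
by have -> : (j.+1%:Z - 1 = j%:Z)%R by lia.
Qed.

Section Matching.
Variables (K : numFieldType) (c q : K) (eps : aw_type).
Hypothesis c0 : c != 0.
Hypothesis q0 : q != 0.
Hypothesis q_generic : forall j : nat, q ^+ j.+1 != 1.
Hypothesis c_generic : forall j : nat, c * q ^ (j%:Z - 1) != 1.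
Local Notation d := (aw_shift eps).

(** The 6W5 sum with [a = c q^(k+d-1)], [b = q^(k+d)] and third parameter
    [c q^(2k+r+d)], for which [a q / b = c] and the two other quotients are
    negative powers of [q]. *)
Lemma sum_inner_term k r :
  \sum_(s < r.+1) inner_term c q eps (k + r) k s =
  qpoch (c * q ^+ (k + d)) q r * qpoch (q ^- (k + r + k + d)) q r /
  (qpoch c q r * qpoch (q ^- (k + r)) q r).
Proof.
have cn0 m : c * q ^+ m != 0 by rewrite mulf_neq0 ?expf_neq0.
have e1 : inner_base c q eps k * q / q ^+ (k + d) = c.
  by rewrite (inner_baseM c eps q0) mulfK // expf_neq0.
have e2 : inner_base c q eps k * q / (c * q ^+ (k + r + k + d)) =
    q ^- (k + r).
  rewrite (inner_baseM c eps q0).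
  have -> : (k + r + k + d = (k + r) + (k + d))%N by lia.
  rewrite (exprD q (k + r) (k + d)).
  move: (expf_neq0 (k + r) q0) (expf_neq0 (k + d) q0).
  by move: (q ^+ (k + r)) (q ^+ (k + d)) => x y *; fieldnz.
have e3 : inner_base c q eps k * q /
    (q ^+ (k + d) * (c * q ^+ (k + r + k + d))) = q ^- (k + r + k + d).
  rewrite (inner_baseM c eps q0).
  move: (expf_neq0 (k + r + k + d) q0) (expf_neq0 (k + d) q0).
  by move: (q ^+ (k + r + k + d)) (q ^+ (k + d)) => x y *; fieldnz.
rewrite /inner_term addKn sum_vwp65 ?expf_neq0 ?cn0 //.
- by rewrite e1 e2 e3 (inner_baseM c eps q0).
- by rewrite /inner_base mulf_neq0 // expfz_neq0.
- move=> i; rewrite /inner_base -mulrA -[_ ^+ i]/(q ^ i%:Z) -expfzDr //.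
  have -> : ((k + d)%N%:Z - 1 + i%:Z = (k + d + i)%N%:Z - 1)%R by lia.
  exact: c_generic.
- by rewrite e1; apply: cq_neq0; apply: c_generic_nat c_generic.
- rewrite e2; apply: qpoch_neq0 => i ltir.
  have -> : q ^- (k + r) * q ^+ i = q ^- (k + r - i).-1.+1.
    rewrite prednK; last by lia.
    have -> : q ^+ (k + r) = q ^+ (k + r - i) * q ^+ i.
      by rewrite -exprD subnK; last lia.
    by rewrite invfM -mulrA mulVf ?mulr1 ?expf_neq0.
  by rewrite invr_eq1.
Qed.

(** Once reversed, the symbols in negative powers of [q] become quotients of
    [(q; q)_m], and the symbols in [c q^m] are quotients of [(c; q)_m].  With
    [n = k + r] every exponent of [q] becomes a combination of [C(k, 2)],
    [C(r, 2)], [k r], [r^2], [k], [d k] and [d r], once [k^2] is written as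
    [2 C(k, 2) + k]; the identity is then one between monomials. *)
Lemma limit_coef_lommel k r (n := (k + r)%N) :
  limit_coef c q eps n k * (\sum_(s < r.+1) inner_term c q eps n k s) *
    (q ^+ 'C(k, 2) / (q ^+ d) ^+ k) =
  lommel_coef c q (2 * n + d) r.
Proof.
rewrite {}/n sum_inner_term /limit_coef /lommel_coef /qbinom.
have Q m := qq_neq0 q_generic m.
have C m := cq_neq0 (c_generic_nat c_generic) m.
have -> : (2 * (k + r) + d - r = k + r + k + d)%N by lia.
have -> : (r <= k + r + k + d)%N by lia.
have -> : (k + r + k + d - r = k + k + d)%N by lia.
rewrite !qpoch_reverse //; try lia.
have -> : (k + r - k = r)%N by lia.
have -> : (k + r - r = k)%N by lia.
have -> : (k + r + k + d - r = k + k + d)%N by lia.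
have shiftc m l : qpoch (c * q ^+ m) q l = qpoch c q (m + l) / qpoch c q m.
  by rewrite qpochD mulrAC divff ?mul1r.
rewrite !shiftc.
have -> : (k + r + d + (k + r) = 2 * (k + r) + d)%N by lia.
have -> : (k + r + d + k = k + r + k + d)%N by lia.
have -> : (d + (k + r) = k + r + d)%N by lia.
have -> : (k + d + r = k + r + d)%N by lia.
have -> : (d + k = k + d)%N by lia.
have -> : ((k + r) * k = k * k + k * r)%N by lia.
have -> : ((k + r) * r = k * r + r * r)%N by lia.
have -> : ((k + r + k + d) * r = k * r + k * r + r * r + d * r)%N by lia.
rewrite bin2D [(k * k)%N]sqrn_bin2.
rewrite (exprNn (q ^+ d)) (exprD (q ^+ d)) (exprD (- c)) -signr_odd.
rewrite !(exprD q) (exprM q d r).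
have nz1 m : (-1) ^+ m != 0 :> K by rewrite signr_eq0.
have nzc m : (- c) ^+ m != 0 by rewrite expf_neq0 ?oppr_eq0.
have nzd m : (q ^+ d) ^+ m != 0 by rewrite !expf_neq0.
have nzq m : q ^+ m != 0 by rewrite expf_neq0.
(* The square of this sign is left over, besides signs that cancel formally. *)
have sgn2 : (-1) ^+ odd (k + r) = 1 :> K \/ (-1) ^+ odd (k + r) = -1 :> K.
  by case: odd; [right|left].
move: (Q (k + r)%N) (Q k) (Q r) (Q (k + k + d)%N).
move: (C (2 * (k + r) + d)%N) (C (k + r + d)%N) (C (k + r + k + d)%N).
move: (C (k + d)%N) (C d) (C r).
do 6! [move: (qpoch c q _) => ?]; do 5! [move: (qpoch q q _) => ?].
move: (nz1 k) (nz1 r) (nzc k) (nzd k) (nzd r).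
move: (nzq 'C(k, 2)) (nzq 'C(r, 2)) (nzq (k * r)%N) (nzq (r * r)%N) (nzq k).
move: ((- c) ^+ k) ((- c) ^+ r) ((-1) ^+ k) ((-1) ^+ r).
move: ((q ^+ d) ^+ k) ((q ^+ d) ^+ r) (q ^+ 'C(k, 2)) (q ^+ 'C(r, 2)).
move: (q ^+ (k * r)) (q ^+ (r * r)) (q ^+ k) => *.
by case: sgn2 => ->; fieldnz.
Qed.

End Matching.

Theorem theorem4p8 (K : numFieldType) (c q : K)
  (hc : c != 0) (hq : q != 0)
  (q_generic : forall j : nat, q ^+ j.+1 != 1)
  (c_generic : forall j : nat, c * q ^ (j%:Z - 1) != 1)
  (n : nat) :
  coef_lim_infty
    (fun alpha =>
       ((- 2) ^+ n / alpha ^+ (2 * n)) *: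
         (assocAW Eps2 1 (q / alpha ^+ 2) c 1 alpha q n
            \Po ((- (alpha ^+ 2 / 2)) *: 'X^2)))
    (qlommel c q (2 * n))
  /\
  exists2 L : {poly K},
    coef_lim_infty
      (fun alpha =>
         ((- 2 * q) ^+ n / alpha ^+ (2 * n)) *:
           (assocAW Eps1 1 (q ^+ 2 / alpha ^+ 2) c 1 alpha q n
              \Po ((- (alpha ^+ 2 / (2 * q))) *: 'X^2)))
      L
    & qlommel c q (2 * n + 1) = 'X * L.
Proof.
have limE eps : coef_lim_infty
    (fun a => ((- 2 * q ^+ aw_shift eps) ^+ n / a ^+ (2 * n)) *:
      (assocAW eps 1 (q ^+ (aw_shift eps).+1 / a ^+ 2) c 1 a q n
         \Po (- (a ^+ 2 / (2 * q ^+ aw_shift eps)) *: 'X^2)))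
    (\sum_(k < n.+1)
       lommel_coef c q (2 * n + aw_shift eps) (n - k) *: 'X^(2 * k)).
  have := @coef_lim_assocAW K c q eps n hc hq q_generic.
  congr (coef_lim_infty _ _); apply: eq_bigr => -[k /= ltkn] _.
  rewrite scalerA; congr (_ *: _).
  have [r nE] : exists r, n = (k + r)%N by exists (n - k)%N; lia.
  by rewrite nE addKn limit_coef_lommel.
have lommelE e : (e <= 1)%N -> qlommel c q (2 * n + e) =
    'X^e * \sum_(k < n.+1) lommel_coef c q (2 * n + e) (n - k) *: 'X^(2 * k).
  move=> le1; have cgen := c_generic_nat c_generic.
  rewrite (qlommel_explicit hq q_generic cgen (S := n.+1)); last by lia.
  rewrite (reindex_inj rev_ord_inj) mulr_sumr; apply: eq_bigr => -[k /= ltkn] _.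
  by rewrite -scalerAr -exprD subSS; congr (_ *: 'X^_); lia.
split.
  have := limE Eps2; rewrite /= addn0 !mulr1.
  by have := lommelE 0%N isT; rewrite addn0 mul1r => ->.
eexists; last exact: (lommelE 1%N isT).
exact: limE Eps1.
Qed.
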